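(* Let $X$ be a compact subset of a real Banach space $\mathfrak{B}$ with finite box-counting dimension $d_B(X)$. Then for every $\alpha>1+d_B(X)$ there exist a separable Hilbert space $H$, a linear map $\Phi:\mathfrak{B}\to H$ and a constant $C_\alpha>0$ such that for all $x,y\in X$ $$C_\alpha^{-1}\|x-y\|^{\alpha}\le\|\Phi(x)-\Phi(y)\|_H\le C_\alpha\|x-y\|.$$
   Context: Box-counting dimension: $d_B(X)=\limsup_{\epsilon\to0}\frac{\log N(X,\epsilon)}{-\log\epsilon}$, where $N(X,\epsilon)$ is the minimum number of balls of radius $\epsilon$ with centres in $X$ required to cover $X$. *)

(* Defs.v *)
From HB Require Import structures.
From mathcomp Require Import all_boot all_order all_algebra.
From mathcomp Require Import all_classical all_reals all_analysis.

Set Implicit Arguments.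
Unset Strict Implicit.
Unset Printing Implicit Defensive.

Import Order.TTheory GRing.Theory Num.Theory numFieldNormedType.Exports.

Local Open Scope classical_set_scope.
Local Open Scope ring_scope.

(* [ball c e] is open. The value is +oo if X has no finite cover of this form;
   for compact X and 0 < e the infimum is attained at a natural number. *)
Definition covering_number (R : realType) (B : normedModType R) (X : set B)
    (e : R) : \bar R :=
  ereal_inf [set (size s)%:R%:E | s in [set s : seq B |
    (forall c, c \in s -> X c) /\ X `<=` \bigcup_(c in [set` s]) ball c e]].

(* [lne] is the logarithm on \bar R, with lne 0 = -oo, so the dimension of the
   empty set is -oo; it is nonnegative for nonempty X. *)
Definition box_dim (R : realType) (B : normedModType R) (X : set B) : \bar R :=
  limf_esup (fun e : R => lne (covering_number X e) / (- ln e)%:E)%E 0^'+.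

(* Over the identity involution, {dot H for idfun} is the type of symmetric
   positive definite bilinear forms, i.e., real inner products. *)
Definition is_hilbert (R : realType) (H : completeNormedModType R) : Prop :=
  exists ip : {dot H for (@idfun R)}, forall x : H, `|x| ^+ 2 = ip x x.

Definition separable (T : topologicalType) : Prop :=
  exists D : set T, countable D /\ dense D.

(* Main.v *)
(** Let [delta] satisfy [box_dim X < delta] and [1 + delta < alpha].  For a small
    ratio [t] and each scale [rho = t ^+ k.+1], cover [X] by at most
    [rho `^ (- delta)] balls of radius [rho].  By the Hahn-Banach theorem every
    difference of two centres has a norming functional; weight all those of
    level [k] by [rho `^ (alpha - 1)] and use them, over all levels, as the
    coordinates of a map into the sequence space l^2.  The square of its norm
    is at most the sum of the [rho `^ (2 * (alpha - 1 - delta))], a convergent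
    geometric series.  If [`|x - y|] is at least [5 * rho], the functional of the
    centres nearest to [x] and [y] is at least [rho] on [x - y] before
    weighting, hence [`|Phi x - Phi y|] is at least [rho `^ alpha]; choose the
    largest such [rho], which is comparable to [`|x - y|]. *)
Require Import Defs.
From HB Require Import structures.
From mathcomp Require Import all_boot all_order all_algebra.
From mathcomp Require Import all_classical all_reals all_analysis.
From mathcomp Require Import ring lra.
Import Order.TTheory GRing.Theory Num.Theory numFieldNormedType.Exports.
Local Open Scope classical_set_scope.
Local Open Scope ring_scope.

(** * The Hilbert space of square-summable sequences *)

(** Packed as a predicate so that its closure under linear combinations can be registered and [ell2]
    inherits a module structure as a subtype. *)
Definition sqsummable {R : realType} : {pred nat -> R} :=
  mem [set x : nat -> R | cvgn (series (fun n => x n ^+ 2))].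

Lemma sqsummable_bounded {R : realType} (x : nat -> R) (M : R) :
  (forall n, \sum_(0 <= i < n) x i ^+ 2 <= M) -> x \in sqsummable.
Proof.
move=> xM; rewrite inE /=; apply: nondecreasing_is_cvgn.
  by apply: nondecreasing_series => n _ _; exact: sqr_ge0.
by exists M => _ [n _ <-]; exact: xM.
Qed.

(** Absolute convergence, by comparison: the absolute value of a product is at most the sum of the
    two squares. *)
Lemma sqsummable_cvg_mul {R : realType} (x y : nat -> R) :
  x \in sqsummable -> y \in sqsummable -> cvgn (series (fun n => x n * y n)).
Proof.
rewrite !inE /= => cx cy; apply: normed_cvg.
apply: (@series_le_cvg _ _ ((fun n => x n ^+ 2) + (fun n => y n ^+ 2))) => //=.
- by move=> n; apply: addr_ge0; exact: sqr_ge0.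
- move=> n; rewrite fctE ler_norml; apply/andP; split; nra.
- exact: is_cvg_seriesD.
Qed.

Lemma sqsummable_submod_closed {R : realType} :
  submod_closed (@sqsummable R).
Proof.
split.
  apply: (@sqsummable_bounded _ _ 0) => n.
  by rewrite big1 // => i _; rewrite expr0n.
move=> a x y xS yS.
have := xS; have := yS; rewrite !inE /= => cx cy.
have -> : (fun n => (a *: x + y) n ^+ 2) =
  a ^+ 2 *: (fun n => x n ^+ 2) +
    ((a *+ 2) *: (fun n => x n * y n) + (fun n => y n ^+ 2)).
  by apply/funext => n; rewrite !fctE /GRing.scale /=; ring.
apply: is_cvg_seriesD; first exact: is_cvg_seriesZ.
by apply: is_cvg_seriesD => //; apply/is_cvg_seriesZ/sqsummable_cvg_mul.
Qed.

HB.instance Definition _ (R : realType) :=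
  GRing.isSubmodClosed.Build R (nat -> R) (@sqsummable R) sqsummable_submod_closed.

Record ell2 (R : realType) :=
  Ell2 { ell2_fun :> nat -> R ; ell2P : ell2_fun \in sqsummable }.

HB.instance Definition _ (R : realType) := [isSub for @ell2_fun R].
HB.instance Definition _ (R : realType) := [Choice of ell2 R by <:].
HB.instance Definition _ (R : realType) := [SubChoice_isSubLmodule of ell2 R by <:].

(** * The inner product of l^2 and its norm *)

Definition ell2_dot {R : realType} (x y : ell2 R) : R :=
  limn (series (fun n => x n * y n)).

Section ell2_dot_theory.
Context {R : realType}.
Implicit Types (x y z : ell2 R) (a : R).

Let cvg_dot x y : cvgn (series (fun n => x n * y n)).
Proof. exact: sqsummable_cvg_mul (ell2P _ x) (ell2P _ y). Qed.

Lemma ell2_dotC x y : ell2_dot x y = ell2_dot y x.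
Proof. by rewrite /ell2_dot; under eq_fun do rewrite mulrC. Qed.

Lemma ell2_dotDl x y z : ell2_dot (x + y) z = ell2_dot x z + ell2_dot y z.
Proof.
rewrite /ell2_dot -lim_seriesD //; congr (limn (series _)).
by apply/funext => n; rewrite !fctE mulrDl.
Qed.

Lemma ell2_dotZl a x y : ell2_dot (a *: x) y = a * ell2_dot x y.
Proof.
rewrite /ell2_dot -[RHS](lim_seriesZ a (cvg_dot x y)); congr (limn (series _)).
by apply/funext => n; rewrite !fctE /GRing.scale /= mulrA.
Qed.

Lemma ell2_dotDr x y z : ell2_dot x (y + z) = ell2_dot x y + ell2_dot x z.
Proof. by rewrite ell2_dotC ell2_dotDl !(ell2_dotC x). Qed.

Lemma ell2_dotZr a x y : ell2_dot x (a *: y) = a * ell2_dot x y.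
Proof. by rewrite ell2_dotC ell2_dotZl ell2_dotC. Qed.

Lemma ell2_dot_ge_sum x n : \sum_(0 <= i < n) x i ^+ 2 <= ell2_dot x x.
Proof.
by apply: nondecreasing_cvgn_le => //; apply: nondecreasing_series => i _ _;
  rewrite -expr2 sqr_ge0.
Qed.

Lemma ell2_dot_le x (M : R) :
  (forall n, \sum_(0 <= i < n) x i ^+ 2 <= M) -> ell2_dot x x <= M.
Proof.
move=> xM; apply: limr_le; first exact: cvg_dot.
by apply: nearW => n; rewrite /series /=; under eq_bigr do rewrite -expr2.
Qed.

Lemma ell2_dot_coord x n : x n ^+ 2 <= ell2_dot x x.
Proof.
apply: le_trans (ell2_dot_ge_sum x n.+1).
by rewrite big_nat_recr //= ler_wpDl // sumr_ge0 // => i _; exact: sqr_ge0.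
Qed.

Lemma ell2_dot_ge0 x : 0 <= ell2_dot x x.
Proof. exact: le_trans (sqr_ge0 _) (ell2_dot_coord x 0). Qed.

Lemma ell2_dot_eq0 x : ell2_dot x x = 0 -> x = 0.
Proof.
move=> x0; apply/val_inj/funext => n /=.
by apply/eqP; rewrite -sqrf_eq0 eq_le sqr_ge0 andbT -x0 ell2_dot_coord.
Qed.

(** For [y] nonzero, subtracting from [x] its projection onto [y] leaves a vector of nonnegative
    square. *)
Lemma ell2_cauchy_schwarz x y :
  ell2_dot x y ^+ 2 <= ell2_dot x x * ell2_dot y y.
Proof.
have [y0|y0] := eqVneq (ell2_dot y y) 0.
  have := ell2_dotZr 0 x 0; rewrite scale0r mul0r y0 (ell2_dot_eq0 _ y0) => ->.
  by rewrite mulr0 expr0n.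
have := ell2_dot_ge0 (x + (- (ell2_dot x y / ell2_dot y y)) *: y).
rewrite ell2_dotDl !ell2_dotDr !(ell2_dotZl, ell2_dotZr) (ell2_dotC y x).
have yp : 0 < ell2_dot y y by rewrite lt_def y0 ell2_dot_ge0.
have -> : ell2_dot x x + - (ell2_dot x y / ell2_dot y y) * ell2_dot x y +
 (- (ell2_dot x y / ell2_dot y y) * ell2_dot x y +
  - (ell2_dot x y / ell2_dot y y) *
  (- (ell2_dot x y / ell2_dot y y) * ell2_dot y y)) =
  ell2_dot x x - ell2_dot x y ^+ 2 / ell2_dot y y by field.
by rewrite subr_ge0 ler_pdivrMr.
Qed.

Definition ell2_norm x : R := Num.sqrt (ell2_dot x x).

Lemma ell2_normD x y : ell2_norm (x + y) <= ell2_norm x + ell2_norm y.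
Proof.
rewrite /ell2_norm -(@ler_pXn2r _ 2) // ?nnegrE ?addr_ge0 ?sqrtr_ge0 //.
rewrite sqrrD !sqr_sqrtr ?ell2_dot_ge0 //.
rewrite ell2_dotDl !ell2_dotDr (ell2_dotC y x).
have : ell2_dot x y <= Num.sqrt (ell2_dot x x) * Num.sqrt (ell2_dot y y).
  rewrite -sqrtrM ?ell2_dot_ge0 //; apply: le_trans (ler_norm _) _.
  by rewrite -sqrtr_sqr ler_wsqrtr // ell2_cauchy_schwarz.
by move=> ?; lra.
Qed.

Lemma ell2_normZ a x : ell2_norm (a *: x) = `|a| * ell2_norm x.
Proof.
rewrite /ell2_norm ell2_dotZl ell2_dotZr mulrA -expr2 sqrtrM ?sqr_ge0 //.
by rewrite sqrtr_sqr.
Qed.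

Lemma ell2_norm_eq0 x : ell2_norm x = 0 -> x = 0.
Proof.
move=> /eqP; rewrite sqrtr_eq0 => x0; apply: ell2_dot_eq0.
by apply/eqP; rewrite eq_le x0 ell2_dot_ge0.
Qed.

End ell2_dot_theory.

HB.instance Definition _ (R : realType) :=
  Lmodule_isNormed.Build R (ell2 R) ell2_normD ell2_normZ ell2_norm_eq0.

Section ell2_dot_form.
Context {R : realType}.

Lemma ell2_dot_bilinear :
  bilinear_for (GRing.Scale.Law.clone _ _ ( *%R) _)
    (GRing.Scale.Law.clone _ _ (@idfun R \; *%R) _) (@ell2_dot R).
Proof.
split=> z a x y.
  by rewrite ell2_dotDl ell2_dotZl.
by rewrite ell2_dotDr ell2_dotZr.
Qed.

HB.instance Definition _ :=
  bilinear_isBilinear.Build R (ell2 R) (ell2 R) R _ _ (@ell2_dot R) ell2_dot_bilinear.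

Lemma ell2_dot_hermitian (x y : ell2 R) :
  ell2_dot x y = (-1) ^+ false * @idfun R (ell2_dot y x).
Proof. by rewrite expr0 mul1r /= ell2_dotC. Qed.

HB.instance Definition _ :=
  isHermitianSesquilinear.Build R (ell2 R) false idfun (@ell2_dot R) ell2_dot_hermitian.

Lemma ell2_dot_gt0 (x : ell2 R) : x != 0 -> 0 < ell2_dot x x.
Proof.
move=> x0; rewrite lt_def ell2_dot_ge0 andbT.
by apply: contra x0 => /eqP/ell2_dot_eq0 ->.
Qed.

HB.instance Definition _ := isDotProduct.Build R (ell2 R) (@ell2_dot R) ell2_dot_gt0.

End ell2_dot_form.

(** * Coordinate estimates and completeness of l^2 *)

Section ell2_topology.
Context {R : realType}.
Implicit Types (x y z : ell2 R).

Lemma ell2B x y n : (x - y) n = x n - y n. Proof. by []. Qed.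

Lemma ell2_normE x : `|x| ^+ 2 = ell2_dot x x.
Proof. by rewrite sqr_sqrtr // ell2_dot_ge0. Qed.

Lemma ell2_coord_le x n : `|x n| <= `|x|.
Proof.
by rewrite -ler_sqr ?nnegrE // ell2_normE real_normK ?num_real // ell2_dot_coord.
Qed.

Lemma ell2_sum_le_norm x n : \sum_(0 <= i < n) x i ^+ 2 <= `|x| ^+ 2.
Proof. by rewrite ell2_normE ell2_dot_ge_sum. Qed.

Lemma ell2_norm_le x (M : R) : 0 <= M ->
  (forall n, \sum_(0 <= i < n) x i ^+ 2 <= M ^+ 2) -> `|x| <= M.
Proof. by move=> M0 xM; rewrite -ler_sqr ?nnegrE // ell2_normE ell2_dot_le. Qed.

(** Coordinates are 1-Lipschitz, so they converge along [F]; bounds on finite partial sums survive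
    the passage to this coordinatewise limit [z]. *)
Lemma ell2_complete (F : set_system (ell2 R)) :
  ProperFilter F -> cauchy F -> cvg F.
Proof.
move=> FF /cauchyP Fc.
have Fcoord n : cvg ((fun x => x n) @ F).
  apply/cauchy_cvgP/cauchyP => e e0.
  have [x Fx] := Fc _ e0; exists (x n).
  apply: (@filterS _ F _ _ _ _ Fx) => y; rewrite -!ball_normE /= => xy.
  by rewrite -ell2B; exact: le_lt_trans (ell2_coord_le _ _) xy.
pose z n : R := lim ((fun x => x n) @ F).
(* With [n] fixed the sum is finite, so the bound valid for every [y] in the ball passes to the
   limit along [F], uniformly in [n]. *)
have zle x e : 0 < e -> F (ball x e) -> forall n,
    \sum_(0 <= i < n) (x i - z i) ^+ 2 <= e ^+ 2.
  move=> e0 Fx n.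
  have zc : (fun y : ell2 R => \sum_(0 <= i < n) (x i - y i) ^+ 2) @ F -->
      \sum_(0 <= i < n) (x i - z i) ^+ 2.
    apply: cvg_big => [|i _]; first exact: add_continuous.
    by apply: cvgM; apply: cvgB; try exact: cvg_cst; exact: Fcoord.
  rewrite -(cvg_lim _ zc) //; apply: limr_le; first by apply: cvgP zc.
  apply: filterS Fx => y; rewrite -ball_normE /= => /ltW xy.
  apply: le_trans (ell2_sum_le_norm (x - y) n) _.
  by apply: lerXn2r; rewrite ?nnegrE // ltW.
(* Write [z] as [x - (x - z)], where [x] is the centre of a unit ball belonging to [F]. *)
have zS : z \in sqsummable.
  have [x Fx] := Fc _ (@ltr01 R).
  have xzS : ((x : nat -> R) - z) \in sqsummable.
    by apply: (@sqsummable_bounded _ _ (1 ^+ 2)) => n; exact: zle.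
  by rewrite -[z](subKr (x : nat -> R)) rpredB // ell2P.
apply/cvg_ex; exists (Ell2 _ _ zS); apply/cvg_ballP => e e0.
have e20 : 0 < e / 2 by rewrite divr_gt0.
have [x Fx] := Fc _ e20; apply: filterS (Fx) => y.
rewrite -!ball_normE /= => xy; rewrite -[_ - y](subrKA x) (splitr e).
apply: le_lt_trans (ler_normD _ _) _; apply: ler_ltD => //.
by rewrite distrC; apply: ell2_norm_le; [exact: ltW|move=> n; exact: zle].
Qed.

HB.instance Definition _ := Uniform_isComplete.Build (ell2 R) ell2_complete.

Lemma ell2_hilbert : is_hilbert (ell2 R).
Proof. by exists (@ell2_dot R) => x; exact: ell2_normE. Qed.

End ell2_topology.

(** * Separability of l^2 *)

Section ell2_separable.
Context {R : realType}.

Lemma finsupp_sqsummable (x : nat -> R) (N : nat) :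
  (forall i, (N <= i)%N -> x i = 0) -> x \in sqsummable.
Proof.
move=> x0; apply: (@sqsummable_bounded _ _ (\sum_(0 <= i < N) x i ^+ 2)) => n.
have -> : \sum_(0 <= i < N) x i ^+ 2 = \sum_(0 <= i < n + N) x i ^+ 2.
  rewrite (@big_cat_nat _ _ _ N 0 (n + N)) ?leq_addl //=.
  rewrite [X in _ = _ + X]big_nat [X in _ = _ + X]big1 ?addr0 // => i /andP[Ni _].
  by rewrite x0 // expr0n.
rewrite [leRHS](@big_cat_nat _ _ _ n) ?leq_addr //= lerDl sumr_ge0 // => i _.
exact: sqr_ge0.
Qed.

Lemma ratseq_sqsummable (q : seq rat) :
  (fun n => ratr q`_n : R) \in sqsummable.
Proof.
by apply: (@finsupp_sqsummable _ (size q)) => i qi; rewrite nth_default // rmorph0.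
Qed.

(** Entries past the end of [q] take the default value [0]; as [seq rat] is countable, the range is
    the countable dense set. *)
Definition ell2_of_ratseq (q : seq rat) : ell2 R := Ell2 _ _ (ratseq_sqsummable q).

(** Truncate where the tail is small and round the remaining coordinates; head and tail each cost at
    most half of [(e / 2) ^+ 2]. *)
Lemma ell2_ratseq_approx (x : ell2 R) (e : R) : 0 < e ->
  exists q, `|x - ell2_of_ratseq q| < e.
Proof.
move=> e0.
have [N xN] : exists N, ell2_dot x x - (e / 2) ^+ 2 / 2 < \sum_(0 <= i < N) x i ^+ 2.
  apply/not_existsP => xN.
  have : ell2_dot x x <= ell2_dot x x - (e / 2) ^+ 2 / 2.
    by apply: ell2_dot_le => n; rewrite leNgt; apply/negP/xN.
  have : 0 < (e / 2) ^+ 2 / 2 by rewrite divr_gt0 // exprn_gt0 // divr_gt0.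
  by move=> ? ?; lra.
(* This makes [N] errors of size [d ^+ 2] sum to at most [(e / 2) ^+ 2 / 2]; the successor keeps the
   divisor nonzero when [N] is [0]. *)
pose d : R := e / 2 / (2 * N.+1%:R).
have d0 : 0 < d by rewrite divr_gt0 ?divr_gt0 // mulr_gt0.
have /choice[q xq] : forall i, exists r : rat, `|x i - ratr r| < d.
  move=> i; have /rat_in_itvoo[r] : x i - d < x i + d by lra.
  by rewrite in_itv /= => /andP[rl ru]; exists r; rewrite ltr_norml; lra.
exists (mkseq q N); apply: (@le_lt_trans _ _ (e / 2)); last lra.
apply: ell2_norm_le => [|n]; first lra.
(* Lengthening the sum to [N + n] allows splitting it at [N] whatever [n] is. *)
apply: (@le_trans _ _ (\sum_(0 <= i < N + n) (x - ell2_of_ratseq (mkseq q N)) i ^+ 2)).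
  rewrite [leRHS](@big_cat_nat _ _ _ n) ?leq_addl //= lerDl sumr_ge0 // => i _.
  exact: sqr_ge0.
rewrite (@big_cat_nat _ _ _ N) ?leq_addr //=.
have headP : \sum_(0 <= i < N) (x - ell2_of_ratseq (mkseq q N)) i ^+ 2
    <= (e / 2) ^+ 2 / 2.
  apply: (@le_trans _ _ (\sum_(0 <= i < N) d ^+ 2)).
    rewrite big_nat_cond [leRHS]big_nat_cond; apply: ler_sum => i.
    rewrite andbT => iN; rewrite ell2B /= nth_mkseq //.
    by rewrite -[leLHS]real_normK ?num_real // lerXn2r ?nnegrE // ltW.
  rewrite sumr_const_nat subn0 -[_ *+ N]mulr_natl /d.
  set h := e / 2; rewrite (expr_div_n h) mulrCA ler_wpM2l ?sqr_ge0 //.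
  rewrite ler_pdivrMr ?exprn_gt0 ?mulr_gt0 // -[N.+1%:R]natr1.
  have : 0 <= N%:R :> R by [].
  have -> : 2^-1 * (2 * (N%:R + 1)) ^+ 2 = 2 * (N%:R + 1) ^+ 2 :> R by field.
  by move=> ?; nra.
have tailP : \sum_(N <= i < N + n) (x - ell2_of_ratseq (mkseq q N)) i ^+ 2
    <= (e / 2) ^+ 2 / 2.
  rewrite (@eq_big_nat _ _ _ _ _ _ (fun i => x i ^+ 2)); last first.
    move=> i /andP[Ni _].
    by rewrite ell2B /= nth_default ?size_mkseq // rmorph0 subr0.
  have := ell2_dot_ge_sum x (N + n).
  rewrite (@big_cat_nat _ _ _ N) ?leq_addr //= => ?; lra.
by apply: le_trans (lerD headP tailP) _; lra.
Qed.

Lemma ell2_separable : separable (ell2 R).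
Proof.
exists (range ell2_of_ratseq); split.
  by apply: (sub_countable (card_image_le _ _)); exact: countableP.
move=> O [x Ox] oO.
have /nbhs_ballP[e /= e0 xeO] : nbhs x O by exact: open_nbhs_nbhs.
have [q xq] := ell2_ratseq_approx x e e0.
by exists (ell2_of_ratseq q); split; [apply: xeO; rewrite -ball_normE|exists q].
Qed.

End ell2_separable.

(** * Sequences of functionals as linear maps into l^2 *)

Section ell2_of_functionals.
Context {R : realType} {B : normedModType R}.
Variables (f : nat -> {linear B -> R}) (c : nat -> R) (M : R).
Hypothesis f_le : forall n x, `|f n x| <= c n * `|x|.
Hypothesis c_le : forall n, \sum_(0 <= i < n) c i ^+ 2 <= M ^+ 2.
Hypothesis M_ge0 : 0 <= M.

Let sum_le x n : \sum_(0 <= i < n) f i x ^+ 2 <= (M * `|x|) ^+ 2.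
Proof.
rewrite exprMn; apply: (@le_trans _ _ ((\sum_(0 <= i < n) c i ^+ 2) * `|x| ^+ 2)).
  rewrite mulr_suml; apply: ler_sum => i _.
  rewrite -exprMn -[leLHS]real_normK ?num_real // lerXn2r ?nnegrE //.
  exact: le_trans (normr_ge0 _) (f_le i x).
by rewrite ler_wpM2r ?sqr_ge0.
Qed.

Let fS x : (f ^~ x) \in sqsummable.
Proof. exact: sqsummable_bounded (sum_le x). Qed.

Let Phi x : ell2 R := Ell2 _ _ (fS x).

Let Phi_linear : linear Phi.
Proof.
move=> a x y; apply/val_inj/funext => n /=.
by rewrite linearP.
Qed.

(** The square-summable bounds [c] give the Lipschitz estimate; the coordinate bound lets one
    well-chosen functional yield a lower estimate. *)
Lemma ell2_of_functionals :
  exists Phi : {linear B -> ell2 R}, forall x,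
    `|Phi x| <= M * `|x| /\ forall n, `|f n x| <= `|Phi x|.
Proof.
pose h := GRing.isLinear.Build R B (ell2 R) *:%R Phi Phi_linear.
pose F : {linear B -> ell2 R} := HB.pack Phi h.
exists F => x; split; last by move=> n; exact: (ell2_coord_le (Phi x)).
by apply: ell2_norm_le => [|n]; [rewrite mulr_ge0|exact: sum_le].
Qed.

End ell2_of_functionals.

(** * Norming functionals *)

Section hahn_banach.
Context {R : realType} {V : lmodType R}.
Implicit Types (p q : V -> R) (u v x y : V).

Definition sublinear p :=
  (forall x y, p (x + y) <= p x + p y) /\
  (forall a x, 0 <= a -> p (a *: x) = a * p x).

Lemma sublinear0 p : sublinear p -> p 0 = 0.
Proof. by move=> [_ pZ]; rewrite -(scale0r 0) pZ // mul0r. Qed.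

Lemma sublinear_geN p x : sublinear p -> - p (- x) <= p x.
Proof.
move=> sp; have [pD _] := sp; have := pD x (- x).
by rewrite subrr sublinear0 // => ?; lra.
Qed.

(** The reverse inequality is the assumed one for [a^-1] at the point [a *: x]. *)
Lemma pos_homogeneous_le p : p 0 = 0 ->
  (forall a x, 0 < a -> p (a *: x) <= a * p x) ->
  forall a x, 0 <= a -> p (a *: x) = a * p x.
Proof.
move=> p0 pZ a x; rewrite le_eqVlt => /predU1P[<-|a0].
  by rewrite scale0r mul0r.
apply/eqP; rewrite eq_le pZ //=.
have := pZ a^-1 (a *: x); rewrite invr_gt0 => /(_ a0).
by rewrite scalerA mulVf ?gt_eqF // scale1r mulrC ler_pdivlMr // mulrC.
Qed.

(** The pointwise infimum works: for subadditivity, the smaller of two members of the chain serves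
    at both points. *)
Lemma sublinear_chain_inf (A : set (V -> R)) p0 :
  A !=set0 -> (forall p, A p -> sublinear p /\ forall x, p x <= p0 x) ->
  (forall p q, A p -> A q -> (forall x, p x <= q x) \/ (forall x, q x <= p x)) ->
  exists q, sublinear q /\ forall p, A p -> forall x, q x <= p x.
Proof.
move=> [p1 Ap1] Asub Atot.
pose S x := [set p x | p in A].
(* The lower bound comes from [- p0 (- x) <= - p (- x) <= p x]. *)
have Sinf x : has_inf (S x).
  split; first by exists (p1 x), p1.
  exists (- p0 (- x)) => _ [p Ap <-].
  have [sp pp0] := Asub _ Ap.
  by apply: le_trans (sublinear_geN p x sp); rewrite lerN2 pp0.
have infle p x : A p -> inf (S x) <= p x.
  by move=> Ap; apply: inf_lbound; [case: (Sinf x)|exists p].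
have leinf x b : (forall p, A p -> b <= p x) -> b <= inf (S x).
  move=> bp; apply: lb_le_inf; first by case: (Sinf x).
  by move=> _ [p Ap <-]; exact: bp.
exists (fun x => inf (S x)); split; last by move=> p Ap x; exact: infle.
split.
  move=> x y; rewrite -lerBlDl; apply: (leinf) => p Ap; rewrite lerBlDl -lerBlDr.
  apply: (leinf) => q Aq; rewrite lerBlDr.
  have [pq|qp] := Atot _ _ Ap Aq.
    apply: le_trans (infle p _ Ap) _; have [[pD _] _] := Asub _ Ap.
    by apply: le_trans (pD x y) _; rewrite lerD2r.
  apply: le_trans (infle q _ Aq) _; have [[qD _] _] := Asub _ Aq.
  by apply: le_trans (qD x y) _; rewrite lerD2l.
apply: pos_homogeneous_le => [|a x a0].
  apply/eqP; rewrite eq_le; apply/andP; split.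
    by rewrite -(sublinear0 p1 (Asub _ Ap1).1); exact: infle.
  by apply: (leinf) => p Ap; rewrite sublinear0 //; case: (Asub _ Ap).
rewrite mulrC -ler_pdivrMr //; apply: (leinf) => p Ap; rewrite ler_pdivrMr // mulrC.
by have [[_ pZ] _] := Asub _ Ap; rewrite -pZ ?infle // ltW.
Qed.

(* The largest sublinear [q <= p] such that [q (- v) <= - p v]. *)
Definition tilt p v x : R := inf [set p (x + t *: v) - t * p v | t in [set t | 0 <= t]].

Section tilt_theory.
Variables (p : V -> R) (v : V).
Hypothesis sp : sublinear p.

Let tilt_has_inf x :
  has_inf [set p (x + t *: v) - t * p v | t in [set t | 0 <= t]].
Proof.
split; first by exists (p (x + 0 *: v) - 0 * p v), 0; rewrite /= ?lexx.
exists (- p (- x)) => _ [t /= t0 <-].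
have [pD pZ] := sp; have := pD (x + t *: v) (- x).
by rewrite addrC addKr pZ // => ?; lra.
Qed.

Lemma tilt_le x t : 0 <= t -> tilt p v x <= p (x + t *: v) - t * p v.
Proof.
by move=> t0; apply: inf_lbound; [case: (tilt_has_inf x)|exists t].
Qed.

Let le_tilt x b : (forall t, 0 <= t -> b <= p (x + t *: v) - t * p v) ->
  b <= tilt p v x.
Proof.
move=> bp; apply: lb_le_inf; first by case: (tilt_has_inf x).
by move=> _ [t t0 <-]; exact: bp.
Qed.

Lemma tilt_le_self x : tilt p v x <= p x.
Proof. by have := tilt_le x 0 (lexx _); rewrite scale0r addr0 mul0r subr0. Qed.

(** Take [t = 1] in the infimum. Hence any linear minorant [f] of the tilt satisfies
    [p v <= f v]. *)
Lemma tiltN : tilt p v (- v) <= - p v.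
Proof.
have := tilt_le (- v) 1 ler01.
by rewrite scale1r addNr sublinear0 // mul1r sub0r.
Qed.

(** Parameters [s] at [x] and [t] at [y] combine into [s + t] at [x + y]; scaling the point by [a]
    scales the parameter by [a]. *)
Lemma sublinear_tilt : sublinear (tilt p v).
Proof.
have [pD pZ] := sp; split.
  move=> x y; rewrite -lerBlDl; apply: (le_tilt) => t t0; rewrite lerBlDl -lerBlDr.
  apply: (le_tilt) => s s0; rewrite lerBlDr.
  apply: le_trans (tilt_le (x + y) (s + t) (addr_ge0 s0 t0)) _.
  rewrite scalerDl addrACA; have := pD (x + s *: v) (y + t *: v).
  by move=> ?; lra.
apply: pos_homogeneous_le => [|a x a0].
  apply/eqP; rewrite eq_le; apply/andP; split.
    by rewrite -[leRHS](sublinear0 p) // tilt_le_self.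
  by apply: (le_tilt) => t t0; rewrite add0r pZ // subrr.
rewrite mulrC -ler_pdivrMr //; apply: (le_tilt) => t t0; rewrite ler_pdivrMr // mulrC.
have -> : a * (p (x + t *: v) - t * p v) = p (a *: x + (a * t) *: v) - (a * t) * p v.
  by rewrite mulrBr mulrA -(pZ a) ?(ltW a0) // scalerDr scalerA.
by apply: (tilt_le); rewrite mulr_ge0 // ltW.
Qed.

End tilt_theory.

(* A minimal sublinear functional equals all its tilts, which makes it
   superadditive, hence linear. *)
Lemma minimal_sublinear_linear q : sublinear q ->
  (forall r, sublinear r -> (forall x, r x <= q x) -> r = q) -> linear q.
Proof.
move=> sq qmin; have [qD qZ] := sq.
have qadd x y : q (x + y) = q x + q y.
  apply/eqP; rewrite eq_le qD /=.
  have tq : tilt q y = q.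
    by apply: qmin; [exact: sublinear_tilt|move=> z; exact: tilt_le_self].
  have := tilt_le q y sq x 1 ler01.
  by rewrite tq scale1r mul1r => ?; lra.
have qN x : q (- x) = - q x.
  by apply/eqP; rewrite -addr_eq0 -qadd addNr sublinear0.
move=> a x y; rewrite qadd; congr (_ + _).
have [a0|a0] := leP 0 a; first exact: qZ.
have := qZ (- a) x; rewrite oppr_ge0 => /(_ (ltW a0)).
by rewrite scaleNr qN mulNr => /oppr_inj.
Qed.

(** Zorn's lemma provides a minimal sublinear functional below [p], and minimality forces
    linearity. *)
Lemma hahn_banach_minorant p : sublinear p ->
  exists f : {linear V -> R}, forall x, f x <= p x.
Proof.
move=> sp.
pose T := {q : V -> R | sublinear q /\ forall x, q x <= p x}.
(* The pointwise order is reversed, so that a maximal element is a minimal functional. *)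
pose r (a b : T) := `[< forall x, sval b x <= sval a x >].
have [[q [sq qp]] qmin] : exists a : T, forall b, r a b -> b = a.
  apply: Zorn.
  - by move=> a; apply/asboolP.
  - move=> a b c /asboolP ab /asboolP bc; apply/asboolP => x.
    exact: le_trans (bc x) (ab x).
  - move=> [a Pa] [b Pb] /asboolP /= ab /asboolP /= ba; apply/eq_exist/funext => x.
    by apply/eqP; rewrite eq_le ab ba.
  - move=> A Atot; have [->|/set0P[a0 Aa0]] := eqVneq A set0.
      by exists (exist _ p (conj sp (fun x => lexx (p x)))) => s [].
    have [| | |m [sm mA]] := sublinear_chain_inf (sval @` A) p.
    + by exists (sval a0), a0.
    + by move=> _ [[a Pa] _ <-].
    + move=> _ _ [a Aa <-] [b Ab <-].
      by have [/asboolP|/asboolP] := Atot _ _ Aa Ab; [right|left].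
    have mp x : m x <= p x.
      apply: le_trans (mA (sval a0) _ x) ((svalP a0).2 x).
      by exists a0.
    exists (exist _ m (conj sm mp)) => a Aa; apply/asboolP => x /=.
    by apply: mA; exists a.
have lq : linear q.
  apply: minimal_sublinear_linear => // s ss sq'.
  have sp' x : s x <= p x by exact: le_trans (sq' x) (qp x).
  exact: (congr1 sval (qmin (exist _ s (conj ss sp')) (asboolT sq'))).
pose h := GRing.isLinear.Build R V R *%R q lq.
pose F : {linear V -> R} := HB.pack q h.
by exists F.
Qed.

End hahn_banach.

(** Minorize the tilt at [v] of the seminorm given by [c] times the norm: the tilt forces equality
    at [v]. *)
Lemma norming_functional {R : realType} {V : normedModType R} (c : R) (v : V) :
  0 <= c -> exists f : {linear V -> R},
    (forall x, `|f x| <= c * `|x|) /\ f v = c * `|v|.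
Proof.
move=> c0; have sn : sublinear (fun x : V => c * `|x|).
  split=> [x y|a x a0]; first by rewrite -mulrDr ler_wpM2l // ler_normD.
  by rewrite normrZ ger0_norm // mulrCA.
have [f fp] := hahn_banach_minorant _ (sublinear_tilt _ v sn).
have f_le x : f x <= c * `|x| by exact: le_trans (fp x) (tilt_le_self _ _ sn x).
exists f; split=> [x|].
  by rewrite ler_norml f_le lerNl -linearN -normrN f_le.
apply/eqP; rewrite eq_le f_le -lerN2 -linearN /=.
exact: le_trans (fp _) (tiltN _ _ sn).
Qed.

(** * The embedding *)

(** A limsup below [d] bounds the quotient of logarithms by [d] at all small scales; clearing the
    denominator and exponentiating bounds the covering number. *)
Lemma box_dim_lt_cover {R : realType} {B : normedModType R} (X : set B) (d : R) :
  (box_dim X < d%:E)%E ->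
  exists2 e0, 0 < e0 & forall e, 0 < e < e0 -> exists s : seq B,
    [/\ forall c, c \in s -> X c, X `<=` \bigcup_(c in [set` s]) ball c e &
        (size s)%:R <= e `^ (- d)].
Proof.
rewrite /box_dim /limf_esup => /ereal_inf_lt[_ [V /= V0 <-] Vd].
have [r /= r0 rV] : exists2 r, 0 < r & forall e, 0 < e < r -> V e.
  move: V0 => [r /= r0 rV]; exists r => // e /andP[e0 er].
  by apply: rV => //=; rewrite sub0r normrN gtr0_norm.
(* Scales below [1] make [- ln e] positive, so that the denominator can be cleared. *)
exists (Num.min r 1); first by rewrite lt_min r0 ltr01.
move=> e /andP[e0]; rewrite lt_min => /andP[er e1].
have ln0 : 0 < - ln e by rewrite oppr_gt0 ln_lt0 // e0.
have : (lne (covering_number X e) / (- ln e)%:E < d%:E)%E.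
  by apply: le_lt_trans Vd; apply: ereal_sup_ubound; exists e => //;
    apply: rV; rewrite e0.
rewrite inver gt_eqF // lte_pdivrMr // -EFinM => Nd.
have : (covering_number X e < (e `^ (- d))%:E)%E.
  rewrite ltNge; apply/negP => eN.
  have : (lne (e `^ (- d))%:E <= lne (covering_number X e))%E.
    rewrite lee_lne // in_itv /= leey andbT ?lee_fin ?powR_ge0 //.
    by apply: le_trans eN; rewrite lee_fin powR_ge0.
  by rewrite lne_EFin ?powR_gt0 // ln_powR mulNr -mulrN leNgt Nd.
move=> /ereal_inf_lt[_ [s [sX Xs] <-]]; rewrite lte_fin => /ltW ss.
by exists s.
Qed.

(** Nonnegative double series may be rearranged, so the sum along a bijective enumeration is the
    iterated sum. Surjectivity will locate each pair (level, index) among the coordinates. *)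
Lemma pairing_sum_le {R : realType} (a : nat -> nat -> R) (b : nat -> R) (M : R) :
  (forall k p, 0 <= a k p) ->
  (forall k n, \sum_(0 <= p < n) a k p <= b k) ->
  (forall n, \sum_(0 <= k < n) b k <= M) ->
  exists e : nat -> nat * nat, set_surj setT setT e /\
    forall n, \sum_(0 <= i < n) a (e i).1 (e i).2 <= M.
Proof.
move=> a0 ab bM.
have /card_set_bijP[e eb] : ([set: nat] #= [set: nat * nat])%card.
  by rewrite card_eq_sym card_nat2.
exists e; split; first by case: eb.
move=> n; rewrite -lee_fin -sumEFin.
apply: (@le_trans _ _ (\sum_(i <oo) (a (e i).1 (e i).2)%:E)%E).
  by apply: nneseries_lim_ge => i _ _; rewrite lee_fin.
rewrite nneseries_esumT => [|i]; last by rewrite lee_fin.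
rewrite -(reindex_esum setT setT e (fun kp => (a kp.1 kp.2)%:E)) //.
rewrite [X in (esum X _ <= _)%E](_ : _ = [set: nat] `*`` (fun=> [set: nat])); last first.
  by apply/seteqP; split.
rewrite -(@esum_esum _ _ _ [set: nat] (fun=> [set: nat]) (fun k p => (a k p)%:E));
  last by move=> k p _ _; rewrite lee_fin.
have inner k : (\esum_(p in [set: nat]) (a k p)%:E <= (b k)%:E)%E.
  rewrite -nneseries_esumT => [|p]; last by rewrite lee_fin.
  apply: lime_le; first by apply: is_cvg_nneseries => p _ _; rewrite lee_fin.
  by apply: nearW => m; rewrite sumEFin lee_fin.
rewrite -nneseries_esumT => [|k]; last by apply: esum_ge0 => p _; rewrite lee_fin.
apply: lime_le.
  by apply: is_cvg_nneseries => k _ _; apply: esum_ge0 => p _; rewrite lee_fin.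
apply: nearW => m; apply: (@le_trans _ _ (\sum_(0 <= k < m) (b k)%:E)%E).
  by apply: lee_sum => k _; exact: inner.
by rewrite sumEFin lee_fin.
Qed.

(** The least admissible exponent exists since the powers tend to [0]; scales start at [t], hence
    the separate case [k = 0]. *)
Lemma least_power_below {R : realType} (t s : R) :
  0 < t < 1 -> 0 < s -> exists2 k, t ^+ k.+1 <= s & (k = 0%N \/ s < t ^+ k).
Proof.
move=> /andP[t0 t1] s0.
have [k ks] : exists k, t ^+ k.+1 <= s.
  have tc : t ^+ n @[n --> \oo] --> (0 : R) by apply: cvg_expr; rewrite gtr0_norm.
  have [k _ /(_ k.+1 (leqnSn k)) /= kt] := (cvgr0_norm_lt _ tc) _ s0.
  by exists k; rewrite ltW // (le_lt_trans _ kt) // ler_norm.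
have [m ms mmin] := ex_minnP (ex_intro (fun k => t ^+ k.+1 <= s) k ks).
exists m => //; case: m ms mmin => [|m] ms mmin; first by left.
by right; rewrite ltNge; apply/negP => /mmin; rewrite ltnn.
Qed.

(** * The embedding built from covers at the scales [t ^+ k.+1] *)

Section embedding.
Context {R : realType} {B : normedModType R}.
Variables (X : set B) (alpha d t D : R).
Hypothesis d_ge0 : 0 <= d.
Hypothesis alpha_gt : 1 + d < alpha.
Hypothesis t01 : 0 < t < 1.
Hypothesis D_ge : forall x y, X x -> X y -> `|x - y| <= D.
Variable s : nat -> seq B.
Hypothesis s_cover : forall k, X `<=` \bigcup_(c in [set` s k]) ball c (t ^+ k.+1).
Hypothesis s_size : forall k, (size (s k))%:R <= (t ^+ k.+1) `^ (- d).

Let t0 : 0 < t. Proof. by case/andP: t01. Qed.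
Let tk0 k : 0 < t ^+ k. Proof. exact: exprn_gt0. Qed.

Let pairs k := [seq (c, c') | c <- s k, c' <- s k].

Let size_pairs k : size (pairs k) = (size (s k) ^ 2)%N.
Proof. by rewrite size_allpairs mulnn. Qed.

(** The value [0] past the finite list of pairs lets [p] range over all of [nat] at every level. *)
Let weight k p : R :=
  if (p < size (pairs k))%N then (t ^+ k.+1) `^ (alpha - 1) else 0.

Let diff k p : B := (nth (0, 0) (pairs k) p).1 - (nth (0, 0) (pairs k) p).2.

Let weight_ge0 k p : 0 <= weight k p.
Proof. by rewrite /weight; case: ifP => // _; exact: powR_ge0. Qed.

Let q := (t `^ (alpha - 1 - d)) ^+ 2.

Let q_gt0 : 0 < q. Proof. by rewrite exprn_gt0 // powR_gt0. Qed.

Let q_lt1 : q < 1.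
Proof.
have e0 : 0 < alpha - 1 - d by move: alpha_gt => ?; lra.
case/andP: t01 => _ t1; rewrite /q expr_lt1 ?powR_ge0 //.
have := @gt0_ltr_powR _ _ e0 t 1; rewrite powR1; apply => //;
  rewrite ?nnegrE // ?ltW //.
Qed.

(** With [rho = t ^+ k.+1] there are at most [rho]^ (- d)[squared pairs, each contributing]rho
    [^ (alpha - 1)] squared; the product is [q ^+ k.+1]. *)
Let weight_level k n : \sum_(0 <= p < n) weight k p ^+ 2 <= geometric q q k.
Proof.
have nn a : (t ^+ k.+1) `^ a = (t `^ a) ^+ k.+1.
  by rewrite -(@powR_mulrn _ t k.+1 (ltW t0)) powRAC powR_mulrn // powR_ge0.
apply: (@le_trans _ _ (\sum_(0 <= p < size (pairs k)) ((t ^+ k.+1) `^ (alpha - 1)) ^+ 2)).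
  apply: (@le_trans _ _ (\sum_(0 <= p < n + size (pairs k)) weight k p ^+ 2)).
    rewrite [leRHS](@big_cat_nat _ _ _ n) ?leq_addr //= lerDl sumr_ge0 // => i _.
    exact: sqr_ge0.
  rewrite (@big_cat_nat _ _ _ (size (pairs k))) ?leq_addl //=.
  rewrite [X in _ + X <= _]big_nat [X in _ + X <= _]big1 ?addr0; last first.
    by move=> i /andP[ki _]; rewrite /weight ltnNge ki expr0n.
  rewrite big_nat [leRHS]big_nat; apply: ler_sum => i /andP[_ ik].
  by rewrite /weight ik.
rewrite sumr_const_nat subn0 size_pairs -[_ *+ _]mulr_natl natrX -exprMn.
rewrite /geometric /= -exprS /q -exprM mulnC exprM lerXn2r ?nnegrE //.
- by rewrite mulr_ge0 // powR_ge0.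
- by rewrite exprn_ge0 // powR_ge0.
- rewrite -nn [alpha - 1 - d]addrC [leRHS]powRD; last by apply/implyP => _; rewrite gt_eqF.
  by rewrite ler_wpM2r ?powR_ge0.
Qed.

Lemma ell2_embedding :
  exists (Phi : {linear B -> ell2 R}) (C : R),
      0 < C /\
      forall x y : B, X x -> X y ->
        C^-1 * `|x - y| `^ alpha <= `|Phi x - Phi y| /\
        `|Phi x - Phi y| <= C * `|x - y|.
Proof.
pose M2 := q * (1 - q)^-1.
have M2_ge0 : 0 <= M2 by rewrite mulr_ge0 ?ltW // invr_gt0 subr_gt0.
have [e [esurj eM]] : exists e : nat -> nat * nat, set_surj setT setT e /\
    forall n, \sum_(0 <= i < n) weight (e i).1 (e i).2 ^+ 2 <= M2.
  apply: (pairing_sum_le (fun k p => weight k p ^+ 2) (geometric q q)).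
  - by move=> k p; exact: sqr_ge0.
  - exact: weight_level.
  - by move=> n; apply: geometric_le_lim; rewrite ?ltW // gtr0_norm.
have /choice[f fP] : forall n, exists f : {linear B -> R},
    (forall x, `|f x| <= weight (e n).1 (e n).2 * `|x|) /\
    f (diff (e n).1 (e n).2) =
      weight (e n).1 (e n).2 * `|diff (e n).1 (e n).2|.
  by move=> n; apply: norming_functional.
have [Phi PhiP] : exists Phi : {linear B -> ell2 R}, forall x,
    `|Phi x| <= Num.sqrt M2 * `|x| /\ forall n, `|f n x| <= `|Phi x|.
  apply: (ell2_of_functionals f (fun n => weight (e n).1 (e n).2)).
  - by move=> n x; case: (fP n).
  - by move=> n; rewrite sqr_sqrtr.
  - exact: sqrtr_ge0.
(* The bound [D] on distances serves at level [k = 0], the factor [5] at all later levels. *)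
pose E := Num.max 5 D.
have E0 : 0 < E by rewrite lt_max ltr0n.
pose kappa := t / E.
have kappa0 : 0 < kappa by exact: divr_gt0.
have alpha0 : 0 < alpha by move: alpha_gt d_ge0 => ? ?; lra.
exists Phi, (1 + Num.sqrt M2 + (kappa `^ alpha)^-1).
have kv0 : 0 < (kappa `^ alpha)^-1 by rewrite invr_gt0 powR_gt0.
have sM0 := sqrtr_ge0 M2.
split=> [|x y Xx Xy]; first by lra.
rewrite -linearB; split; last first.
  apply: le_trans (PhiP (x - y)).1 _; rewrite ler_wpM2r //; lra.
apply: (@le_trans _ _ (kappa `^ alpha * `|x - y| `^ alpha)).
  rewrite ler_wpM2r ?powR_ge0 // -[leRHS]invrK lef_pV2 ?posrE //; lra.
have [->|xy] := eqVneq x y.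
  by rewrite subrr normr0 powR0 ?mulr0 ?normr_ge0 // gt_eqF.
have xy0 : 0 < `|x - y| by rewrite normr_gt0 subr_eq0.
(* Of the five radii, two are lost in replacing [x] and [y] by centres and two more in evaluating
   the functional; one remains. *)
have [k k_le k_gt] : exists2 k, t ^+ k.+1 <= `|x - y| / 5 &
    (k = 0%N \/ `|x - y| / 5 < t ^+ k).
  by apply: least_power_below => //; exact: divr_gt0.
have kappa_le : kappa * `|x - y| <= t ^+ k.+1.
  rewrite /kappa -mulrA exprS ler_pM2l // mulrC ler_pdivrMr //.
  case: k_gt => [->|k_gt].
    rewrite expr0 mul1r; apply: le_trans (D_ge _ _ Xx Xy) _.
    by rewrite le_max lexx orbT.
  have : 5 <= E by rewrite le_max lexx.
  have := tk0 k; nra.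
rewrite -powRM ?(ltW kappa0) ?(ltW xy0) //.
apply: (@le_trans _ _ ((t ^+ k.+1) `^ alpha)).
  apply: ge0_ler_powR => //; first exact: ltW.
    by rewrite nnegrE; apply: mulr_ge0; [exact: ltW|exact: ltW].
  by rewrite nnegrE; exact: ltW.
have [c /= cs xc] := s_cover k _ Xx.
have [c' /= c's yc'] := s_cover k _ Xy.
have ccs : (c, c') \in pairs k by apply: allpairs_f.
(* The coordinate [n] found from this index carries the functional norming [c - c']. *)
pose p := index (c, c') (pairs k).
have [n _ en] := esurj (k, p) I.
have [f_le f_diff] := fP n.
have diffE : diff (e n).1 (e n).2 = c - c' by rewrite en /= /diff nth_index.
have weightE : weight (e n).1 (e n).2 = (t ^+ k.+1) `^ (alpha - 1).
  by rewrite en /= /weight index_mem ccs.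
rewrite diffE weightE in f_diff; rewrite weightE in f_le.
apply: le_trans ((PhiP (x - y)).2 n); apply: le_trans (ler_norm _).
have wx : f n (c - x) <= (t ^+ k.+1) `^ (alpha - 1) * t ^+ k.+1.
  apply: le_trans (ler_norm _) _; apply: le_trans (f_le _) _.
  by rewrite ler_wpM2l ?powR_ge0 // ltW //; move: xc; rewrite -ball_normE.
have wy : f n (y - c') <= (t ^+ k.+1) `^ (alpha - 1) * t ^+ k.+1.
  apply: le_trans (ler_norm _) _; apply: le_trans (f_le _) _.
  by rewrite ler_wpM2l ?powR_ge0 // distrC ltW //; move: yc'; rewrite -ball_normE.
have cc : 3 * t ^+ k.+1 <= `|c - c'|.
  have : `|x - y| <= `|c - x| + `|c - c'| + `|c' - y|.
    have -> : x - y = (x - c) + (c - c') + (c' - y) by rewrite !subrKA.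
    by rewrite (distrC c x) (le_trans (ler_normD _ _)) // lerD2r ler_normD.
  move: xc yc'; rewrite -!ball_normE /= => xc yc' ?.
  by move: k_le; rewrite ler_pdivlMr // => ?; lra.
have -> : x - y = (c - c') - (c - x) - (y - c').
  by rewrite !opprB [c - c' + _]addrC !subrKA.
rewrite 2!linearB f_diff.
(* The radius times the weight is the radius to the power [alpha]. *)
rewrite -(mulr_powRB1 (ltW (tk0 k.+1))) //.
have := powR_ge0 (t ^+ k.+1) (alpha - 1).
move: wx wy cc (tk0 k.+1); nra.
Qed.

End embedding.

(** The midpoint of [b] and [a - 1] serves when [b] is finite; the value [-oo] covers the dimension
    of the empty set. *)
Lemma lte_add1_split {R : realType} (b : \bar R) (a : R) :
  (1 + b < a%:E)%E -> exists2 d : R, (b < d%:E)%E & 1 + d < a.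
Proof.
case: b => [b| |] //=; last by exists (a - 2); [exact: ltNyr|lra].
rewrite -EFinD lte_fin => ba; exists ((b + (a - 1)) / 2); last by lra.
by rewrite lte_fin; lra.
Qed.

Theorem proposition2p2 (R : realType) (B : completeNormedModType R)
    (X : set B) (hX : compact X) (hd : (box_dim X < +oo)%E)
    (alpha : R) (halpha : (1 + box_dim X < alpha%:E)%E) :
  exists H : completeNormedModType R,
    is_hilbert H /\ separable H /\
    exists (Phi : {linear B -> H}) (C : R),
      0 < C /\
      forall x y : B, X x -> X y ->
        C^-1 * `|x - y| `^ alpha <= `|Phi x - Phi y| /\
        `|Phi x - Phi y| <= C * `|x - y|.
Proof.
exists (ell2 R); split; first exact: ell2_hilbert.
split; first exact: ell2_separable.
have [d dX da] := lte_add1_split _ _ halpha.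
have [e0 e0_gt0 cover] := box_dim_lt_cover _ _ dX.
have [X0|/set0P[x0 Xx0]] := eqVneq X set0.
  by exists (\0 : {linear B -> ell2 R}), 1; split=> // x y; rewrite X0.
(* Being below both [e0] and [1], this ratio keeps every scale [t ^+ k.+1] in the range where covers
   are available. *)
pose t := Num.min (e0 / 2) 2^-1.
have t01 : 0 < t < 1.
  by rewrite lt_min gt_min divr_gt0 // invr_gt0 ltr0n /= invf_lt1 // ltr1n orbT.
have [t0 t1] := andP t01.
have te0 : t < e0.
  by rewrite (@le_lt_trans _ _ (e0 / 2)) ?ge_min ?lexx //; lra.
have /choice[s sP] : forall k, exists s : seq B,
    [/\ forall c, c \in s -> X c, X `<=` \bigcup_(c in [set` s]) ball c (t ^+ k.+1) &
        (size s)%:R <= (t ^+ k.+1) `^ (- d)].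
  move=> k; apply: cover; rewrite exprn_gt0 //=; apply: le_lt_trans te0.
  by rewrite exprS ler_piMr ?(ltW t0) // exprn_ile1 ?ltW.
(* For negative [d] the bound on the cover's size would be below [1], yet a nonempty set needs at
   least one ball. *)
have d0 : 0 <= d.
  have [_ scov ssize] := sP 0%N.
  rewrite leNgt; apply/negP => dneg.
  have [c /= cs _] := scov _ Xx0.
  have : (1 : R) <= (size (s 0%N))%:R by rewrite ler1n; case: (s 0%N) cs.
  rewrite leNgt; apply/negP/negPn; apply: le_lt_trans ssize _.
  have nd : 0 < - d by rewrite oppr_gt0.
  have := @gt0_ltr_powR _ _ nd t 1; rewrite powR1 expr1; apply => //;
    by rewrite ?nnegrE ?ltW.
(* Every number strictly above [M] bounds the norms on [X], hence [M + 1]; twice this bounds the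
   distances. *)
have [M [_ /(_ (M + 1)) XM]] := compact_bounded hX.
have {}XM : forall x, X x -> `|x| <= M + 1 by apply: XM; rewrite ltrDl.
apply: (@ell2_embedding R B X alpha d t (M + 1 + (M + 1)) d0 da t01 _ s).
- move=> x y Xx Xy; apply: le_trans (ler_normB _ _) _.
  by apply: lerD; exact: XM.
- by move=> k; have [_] := sP k.
- by move=> k; have [] := sP k.
Qed.
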